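(* Let $\mathcal{B}\subseteq\mathcal{C}^n$. Let $\mathcal{L}$ be a family of polyhedra belonging to $\mathcal{C}^n$, and suppose there is $m\in\mathbb{N}$ such that every $L\in\mathcal{L}$ has at most $m$ facets. Then: (a) If $\mathcal{B}$ is $f$-closed for a fixed $f\in\mathbb{R}^n\setminus\mathbb{Z}^n$, then $\rho_f(\mathcal{B},\mathcal{L})<\infty$ if and only if there exists $\mu\in(0,1)$ such that for every $L\in\mathcal{L}_f$ some $B\in\mathcal{B}$ satisfies $B\supseteq\mu L+(1-\mu)f$. (b) If $\mathcal{B}$ is $f$-closed for all $f\in\mathbb{R}^n\setminus\mathbb{Z}^n$, then $\rho(\mathcal{B},\mathcal{L})<\infty$ if and only if there exists $\mu\in(0,1)$ such that for every $f\in\mathbb{R}^n\setminus\mathbb{Z}^n$ and every $L\in\mathcal{L}_f$ some $B\in\mathcal{B}$ satisfies $B\supseteq\mu L+(1-\mu)f$.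
   Context: $\mathcal{C}^n$ is the family of all $n$-dimensional closed convex subsets of $\mathbb{R}^n$. For $B\in\mathcal{C}^n$ with $0\in\operatorname{int}(B)$, $\psi_B(r)=\inf\{\lambda>0:r\in\lambda B\}$. For $k\in\mathbb{N}$, $R=(r_1,\dots,r_k)\in\mathbb{R}^{n\times k}$, $f\in\mathbb{R}^n\setminus\mathbb{Z}^n$, $B\in\mathcal{C}^n$: if $f\in\operatorname{int}(B)$, $C_B(R,f)=\{s\in\mathbb{R}^k_{\ge0}:\sum_j s_j\psi_{B-f}(r_j)\ge1\}$, otherwise $C_B(R,f)=\mathbb{R}^k_{\ge0}$; for $\mathcal{B}\subseteq\mathcal{C}^n$, $C_{\mathcal{B}}(R,f)=\bigcap_{B\in\mathcal{B}}C_B(R,f)$ ($=\mathbb{R}^k_{\ge0}$ if $\mathcal{B}=\emptyset$). For $\mathcal{B},\mathcal{L}\subseteq\mathcal{C}^n$, $\rho_f(\mathcal{B},\mathcal{L})=\inf\{\alpha>0:C_{\mathcal{B}}(R,f)\subseteq\frac1\alpha C_{\mathcal{L}}(R,f)$ for all $k$ and all $R\in\mathbb{R}^{n\times k}\}$ and $\rho(\mathcal{B},\mathcal{L})=\sup_{f\in\mathbb{R}^n\setminus\mathbb{Z}^n}\rho_f(\mathcal{B},\mathcal{L})$. For a family $\mathcal{B}\subseteq\mathcal{C}^n$, $\mathcal{B}_f$ is the subfamily of sets in $\mathcal{B}$ containing $f$ in the interior, and $\mathcal{C}^n_f$ is the family of sets in $\mathcal{C}^n$ containing $f$ in the interior.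 $\mathcal{B}$ is $f$-closed if the family $\{\psi_{B-f}:B\in\mathcal{B}_f\}$ is closed under pointwise convergence within the family $\{\psi_{C-f}:C\in\mathcal{C}^n_f\}$, i.e. whenever $B_t\in\mathcal{B}_f$, $C\in\mathcal{C}^n_f$ and $\psi_{B_t-f}\to\psi_{C-f}$ pointwise, then $C\in\mathcal{B}_f$. *)

(* Defs.v *)
From HB Require Import structures.
From mathcomp Require Import all_boot all_order all_algebra.
From mathcomp Require Import all_classical all_reals all_analysis.
Set Implicit Arguments. Unset Strict Implicit. Unset Printing Implicit Defensive.
Import Order.TTheory GRing.Theory Num.Theory.
Import numFieldNormedType.Exports.
Local Open Scope classical_set_scope.
Local Open Scope ring_scope.

Section Defs.
Variables (R : realType) (n : nat).
Notation V := 'rV[R]_n.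

Definition dotv (u v : V) : R := \sum_(i < n) u ord0 i * v ord0 i.

Definition convex (A : set V) : Prop :=
  forall x y (t : R), A x -> A y -> 0 <= t -> t <= 1 -> A (t *: x + (1 - t) *: y).

(* S contains d+1 affinely independent points *)
Definition affdim_ge (S : set V) (d : nat) : Prop :=
  exists p : 'I_d.+1 -> V, (forall i, S (p i)) /\
    \rank (\matrix_(i < d) (p (lift ord0 i) - p ord0)) = d.

Definition affdim (S : set V) (d : nat) : Prop :=
  affdim_ge S d /\ ~ affdim_ge S d.+1.

Definition in_Cn (B : set V) : Prop := closed B /\ convex B /\ affdim B n.

Definition polyhedron (L : set V) : Prop :=
  exists (k : nat) (a : 'I_k -> V) (b : 'I_k -> R),
    L = [set x | forall i, dotv (a i) x <= b i].

Definition is_facet (L F : set V) : Prop :=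
  (exists (a : V) (b : R), a != 0 /\ (forall x, L x -> dotv a x <= b) /\
     F = [set x | L x /\ dotv a x = b]) /\ affdim F n.-1.

Definition at_most_facets (L : set V) (m : nat) : Prop :=
  exists Fs : 'I_m -> set V, forall F, is_facet L F -> exists i, F = Fs i.

Definition integral_vec (f : V) : Prop := forall i, f ord0 i \is a Num.int.

Definition translate (B : set V) (f : V) : set V := [set x - f | x in B].

Definition scale_set (l : R) (B : set V) : set V := [set l *: x | x in B].

Definition psi (B : set V) (r : V) : R :=
  inf [set l : R | 0 < l /\ scale_set l B r].

Definition nonneg (k : nat) (s : 'I_k -> R) : Prop := forall j, 0 <= s j.

Definition CB (B : set V) (k : nat) (r : 'I_k -> V) (f : V) : set ('I_k -> R) :=
  [set s | nonneg s /\
     (interior B f -> 1 <= \sum_(j < k) s j * psi (translate B f) (r j))].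

(* C_calB(R,f): intersection over the family (= R^k_{>=0} if empty) *)
Definition CFam (cB : set (set V)) (k : nat) (r : 'I_k -> V) (f : V)
  : set ('I_k -> R) :=
  [set s | nonneg s /\ forall B, cB B -> CB B r f s].

Definition scale_fam (k : nat) (a : R) (C : set ('I_k -> R)) : set ('I_k -> R) :=
  [set (fun j => a * t j) | t in C].

(* rho_f(calB, calL) as an extended real (+oo when no alpha works) *)
Definition rho_f (cB cL : set (set V)) (f : V) : \bar R :=
  ereal_inf [set a%:E | a in
    [set a : R | 0 < a /\ forall (k : nat) (r : 'I_k -> V),
        CFam cB r f `<=` scale_fam a^-1 (CFam cL r f)]].

Definition rho (cB cL : set (set V)) : \bar R :=
  ereal_sup [set rho_f cB cL f | f in [set f | ~ integral_vec f]].

Definition fam_f (cB : set (set V)) (f : V) : set (set V) :=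
  [set B | cB B /\ interior B f].

Definition f_closed (cB : set (set V)) (f : V) : Prop :=
  forall (Bt : nat -> set V) (C : set V),
    (forall t, fam_f cB f (Bt t)) ->
    in_Cn C -> interior C f ->
    (forall r, (fun t => psi (translate (Bt t) f) r) @ \oo --> psi (translate C f) r) ->
    fam_f cB f C.

Definition homothety (mu : R) (L : set V) (f : V) : set V :=
  [set mu *: x + (1 - mu) *: f | x in L].

End Defs.

(* Main.v *)
Require Import Defs.
From HB Require Import structures.
From mathcomp Require Import all_boot all_order all_algebra.
From mathcomp Require Import all_classical all_reals all_analysis.
From mathcomp Require Import ring lra.
Import Order.TTheory GRing.Theory Num.Theory.
Import numFieldNormedType.Exports.
Local Open Scope classical_set_scope.
Local Open Scope ring_scope.

(* The direction from homotheties to finiteness is monotonicity of gauges, with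
   [alpha = mu^-1]. Conversely, a polyhedron with at most [m] facets is cut out
   around [f] by [m] inequalities, so the cone over [L - f] is generated by a
   number [K] of vectors depending only on [n] and [m]: pick one vector for each
   set of constraints that is exactly the tight set of some point, and subtract
   from a given point a multiple of the representative of its tight set, which
   enlarges that set. If no [B] contained the scaled generators of [mu L], then
   weighting them by [mu] (and recession directions by a large [N]) would give a
   point of [C_B] that is not in [alpha^-1 C_L] once [alpha mu K < 1]. This yields
   for every [N] a set [B_N] that contains the scaled points and almost the
   recession directions; a limit of the gauges of the [B_N] is the gauge of a set
   containing [mu L + (1 - mu) f], which lies in the family by [f]-closedness. *)

(** * Generators of a polyhedral cone *)

(** Induction on the number of constraints that are not tight at [w]. Only the values [l j w] are
    reproduced, not [w] itself: the constraints do not see lineality directions. *)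
Lemma cone_generators (R : realFieldType) (W : lmodType R) (J : finType)
    (l : J -> W -> R) :
  (forall j a u v, l j (a *: u + v) = a * l j u + l j v) ->
  exists p : {set J} -> W, (forall I j, 0 <= l j (p I)) /\
    forall w, (forall j, 0 <= l j w) ->
      exists c : {set J} -> R, (forall I, 0 <= c I) /\
        forall j, l j w = \sum_I c I * l j (p I).
Proof.
move=> llin.
have l0 j : l j 0 = 0.
  by have := llin j 1 0 0; rewrite scaler0 addr0 mul1r => h; lra.
have lB j s u v : l j (u - s *: v) = l j u - s * l j v.
  by rewrite addrC -scaleNr llin mulNr addrC.
pose tight w := [set j | l j w == 0]%SET.
have /fin_all_exists[p Hp] : forall I : {set J}, exists q, (forall j, 0 <= l j q) /\
    forall w, (forall j, 0 <= l j w) -> tight w = I -> tight q = I.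
  move=> I.
  have [[w [w0 wI]]|nw] := pselect (exists w, (forall j, 0 <= l j w) /\ tight w = I).
    by exists w.
  (* No point of the cone has tight set [I]; [0] is a dummy in the cone and the second clause is
     vacuous. *)
  exists 0; split => [j|w w0 wI]; first by rewrite l0.
  by case: nw; exists w.
exists p; split=> [I j|]; first by have [] := Hp I.
move=> w; have [k] := ubnP #|[set j | l j w != 0]%SET|.
elim: k w => // k IH w; rewrite ltnS => wk w0.
have [[j1 j1w]|nj] := pselect (exists j, l j w != 0); last first.
  exists (fun=> 0); split=> // j; rewrite big1 => [|i _]; last by rewrite mul0r.
  by apply/eqP/negPn/negP => h; apply: nj; exists j.
have [p0 /(_ w w0 erefl) ptight] := Hp (tight w); set q := p (tight w) in p0 ptight.
have qw j : (l j q == 0) = (l j w == 0).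
  by move/setP: ptight => /(_ j); rewrite !inE.
(* The least ratio [s] is the largest multiple of [q] that can be subtracted inside the cone; the
   minimiser [j0] becomes tight, and constraints tight at [w] stay tight. *)
have [j0 j0w j0min] := @arg_minP _ _ _ j1 (fun j => l j w != 0)
  (fun j => l j w / l j q) j1w.
set s := l j0 w / l j0 q.
have pos j : l j w != 0 -> 0 < l j q by move=> h; rewrite lt_def qw h p0.
have s0 : 0 <= s by rewrite divr_ge0.
have w'0 j : 0 <= l j (w - s *: q).
  rewrite lB subr_ge0; have [/eqP lw|lw] := boolP (l j w == 0).
    by rewrite lw (eqP (_ : l j q == 0)) ?mulr0 // qw lw.
  by rewrite -ler_pdivlMr ?pos // j0min.
have [|c [c0 cw]] := IH (w - s *: q) _ w'0.
  apply: leq_trans wk; apply: proper_card; apply/properP; split.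
    apply/fintype.subsetP => j; rewrite !inE; apply: contra => /eqP lw.
    by rewrite lB lw sub0r (eqP (_ : l j q == 0)) ?mulr0 ?oppr0 // qw lw.
  by exists j0; rewrite !inE // negbK lB /s divfK ?subrr // gt_eqF ?pos.
exists (fun I => c I + s *+ (I == tight w)); split => [I|j].
  by rewrite addr_ge0 // mulrn_wge0.
under eq_bigr do rewrite mulrDl.
rewrite big_split /= -cw lB (bigD1 (tight w)) //= eqxx big1 ?addr0 -?/q ?subrK //.
by move=> I /negPf ->; rewrite mul0r.
Qed.

(** * Nonnegative sublinear functionals *)

Section Sublinear.
Context {R : realType} {n : nat}.
Notation V := 'rV[R]_n.

Definition sublinear (phi : V -> R) := [/\ forall x, 0 <= phi x,
  forall x y, phi (x + y) <= phi x + phi y &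
  forall a x, 0 < a -> phi (a *: x) = a * phi x].

Lemma sublinear0 phi : sublinear phi -> phi 0 = 0.
Proof.
by move=> [_ _ /(_ 2 0 (ltr0Sn _ _))]; rewrite scaler0 => h; lra.
Qed.

Lemma sublinearZ phi (a : R) x : sublinear phi -> 0 <= a -> phi (a *: x) = a * phi x.
Proof.
move=> sp; rewrite le_eqVlt => /orP[/eqP <-|]; last by case: sp => _ _; apply.
by rewrite scale0r mul0r sublinear0.
Qed.

Lemma sublinear_sum phi (I : finType) (c : I -> R) (p : I -> V) :
  sublinear phi -> (forall i, 0 <= c i) ->
  phi (\sum_i c i *: p i) <= \sum_i c i * phi (p i).
Proof.
move=> sp c0; elim/big_ind2 : _ => [|x1 x2 y1 y2 h1 h2|i _].
- by rewrite sublinear0.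
- by case: sp => _ sD _; apply: le_trans (sD _ _) (lerD h1 h2).
- by rewrite sublinearZ.
Qed.

(** A Lipschitz constant for the sup norm that involves only the values at the signed basis vectors,
    so pointwise bounds on a sequence make it equi-Lipschitz. *)
Definition sublip (phi : V -> R) : R :=
  \sum_(i < n) (phi (delta_mx ord0 i) + phi (- delta_mx ord0 i)).

Lemma sublip_ge0 phi : sublinear phi -> 0 <= sublip phi.
Proof. by case=> p0 _ _; apply: sumr_ge0 => i _; rewrite addr_ge0. Qed.

Lemma sublinear_le phi (e : R) (v : V) : sublinear phi -> (forall i, `|v ord0 i| <= e) ->
  phi v <= e * sublip phi.
Proof.
move=> sp ve; rewrite [in leLHS](row_sum_delta v) mulr_sumr.
elim/big_ind2 : _ => [|x1 x2 y1 y2 h1 h2|i _].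
- by rewrite sublinear0.
- by case: sp => _ sD _; apply: le_trans (sD _ _) (lerD h1 h2).
have [p0 _ _] := sp; move: (ve i).
have [v0|v0] := leP 0 (v ord0 i).
  rewrite ger0_norm // sublinearZ // => h; rewrite mulrDr.
  rewrite -[leLHS]addr0 lerD //; first by rewrite ler_wpM2r.
  by rewrite mulr_ge0 // (le_trans v0).
rewrite ltr0_norm // -[v ord0 i *: _]opprK -scaleNr -scalerN sublinearZ // => [h|].
  rewrite mulrDr -[leLHS]add0r lerD ?ler_wpM2r //.
  by rewrite mulr_ge0 // (le_trans _ h) // oppr_ge0 ltW.
by rewrite oppr_ge0 ltW.
Qed.

Lemma sublinear_dist phi (e : R) (x y : V) : sublinear phi ->
  (forall i, `|x ord0 i - y ord0 i| <= e) -> `|phi x - phi y| <= e * sublip phi.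
Proof.
move=> sp xy; have [_ sD _] := sp; rewrite ler_norml; apply/andP; split.
  have := sD x (y - x); rewrite subrKC => h.
  have : phi (y - x) <= e * sublip phi.
    by apply: sublinear_le => // i; rewrite !mxE distrC.
  by move=> ?; lra.
have := sD y (x - y); rewrite subrKC => h.
have : phi (x - y) <= e * sublip phi.
  by apply: sublinear_le => // i; rewrite !mxE.
by move=> ?; lra.
Qed.

Lemma interior_rowP (A : set V) (x : V) :
  interior A x <-> exists2 e : R, 0 < e & forall y : V, (forall i, `|x ord0 i - y ord0 i| < e) -> A y.
Proof.
rewrite /interior; split.
  move/nbhs_ballP => [e /= e0 h]; exists e => // y xy; apply: h; split => // i j.
  by rewrite (ord1 i); exact: xy.
move=> [e e0 h]; apply/nbhs_ballP; exists e => //= y [_ xy]; apply: h => i.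
exact: (xy ord0 i).
Qed.

End Sublinear.

(** * Gauges around an interior point *)

Section Gauge.
Context {R : realType} {n : nat}.
Notation V := 'rV[R]_n.
Implicit Types (B C L : set V) (f r x y : V).

Lemma psi_translate B f r : psi (translate B f) r =
  inf [set l : R | 0 < l /\ B (f + l^-1 *: r)].
Proof.
congr inf; apply/seteqP; split => l /= [l0].
  move=> [_ [x Bx <-] <-]; split=> //.
  by rewrite scalerA mulVf ?gt_eqF // scale1r subrKC.
move=> Bx; split=> //; exists (l^-1 *: r).
  by exists (f + l^-1 *: r) => //; rewrite addrAC subrr add0r.
by rewrite scalerA mulfV ?gt_eqF // scale1r.
Qed.

Lemma gauge_le B f r (l : R) : 0 < l -> B (f + l^-1 *: r) ->
  psi (translate B f) r <= l.
Proof.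
move=> l0 Bl; rewrite psi_translate; apply: ge_inf => //.
by exists 0 => z [/ltW].
Qed.

(** Makes the set under the infimum in [psi] nonempty, so that the default value of [inf] never
    occurs. *)
Lemma interior_segment B f r : interior B f -> exists2 l : R, 0 < l & B (f + l^-1 *: r).
Proof.
move=> /interior_rowP[e e0 Be].
pose M := \sum_i `|r ord0 i|.
have M0 : 0 <= M by apply: sumr_ge0.
exists ((M + 1) / e); first by rewrite divr_gt0 // ltr_wpDl.
apply: Be => i; rewrite !mxE opprD addNKr normrN normrM invf_div.
rewrite gtr0_norm ?divr_gt0 ?ltr_wpDl // mulrAC ltr_pdivrMr ?ltr_wpDl //.
rewrite ltr_pM2l // (le_lt_trans _ (_ : M < _)) ?ltrDl //.
by rewrite /M (bigD1 i) //= lerDl sumr_ge0.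
Qed.

Lemma gauge_adherent B f r (e : R) : interior B f -> 0 < e ->
  exists l : R, [/\ 0 < l, B (f + l^-1 *: r) & l < psi (translate B f) r + e].
Proof.
move=> Bf e0; have [l l0 Bl] := interior_segment B f r Bf.
have : has_inf [set l : R | 0 < l /\ B (f + l^-1 *: r)].
  by split; [exists l | exists 0 => z [/ltW]].
move=> /(inf_adherent e0)[k [k0 Bk]]; rewrite -psi_translate => kl.
by exists k.
Qed.

Lemma gauge_sublinear B f : Defs.convex B -> interior B f ->
  sublinear (psi (translate B f)).
Proof.
move=> cB Bf; split=> [x|x y|a x a0].
- rewrite psi_translate; apply: lb_le_inf => [|z [/ltW]//].
  by have [l l0 Bl] := interior_segment B f x Bf; exists l.
- apply/ler_addgt0Pr => e e0; have e2 : 0 < e / 2 by rewrite divr_gt0.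
  have [k [k0 Bk kx]] := gauge_adherent B f x _ Bf e2.
  have [l [l0 Bl ly]] := gauge_adherent B f y _ Bf e2.
  apply: le_trans (_ : k + l <= _); last by lra.
  have kl0 : 0 < k + l by rewrite addr_gt0.
  apply: gauge_le => //.
  (* With this weight, the convex combination of [f + x / k] and [f + y / l] is
     [f + (x + y) / (k + l)]. *)
  have := cB _ _ (k / (k + l)) Bk Bl.
  rewrite divr_ge0 ?(ltW k0) ?(ltW kl0) // ler_pdivrMr // mul1r lerDl (ltW l0).
  move=> /(_ isT isT); congr B; apply/rowP => i; rewrite !mxE.
  by field; rewrite !gt_eqF.
(* One inequality suffices: the other is the same one for the factor [a^-1] at [a *: x]. *)
- have h (b : R) z : 0 < b -> psi (translate B f) (b *: z) <= b * psi (translate B f) z.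
    move=> b0; apply/ler_addgt0Pr => e e0.
    have eb : 0 < e / b by rewrite divr_gt0.
    have [k [k0 Bk kx]] := gauge_adherent B f z _ Bf eb.
    apply: le_trans (_ : b * k <= _); last first.
      have -> : b * psi (translate B f) z + e = b * (psi (translate B f) z + e / b).
        by field; rewrite gt_eqF.
      by rewrite ler_pM2l // ltW.
    apply: gauge_le; first by rewrite mulr_gt0.
    by rewrite scalerA invfM -mulrA [_ * b]mulrC mulrA mulVf ?mul1r ?gt_eqF.
  apply/eqP; rewrite eq_le h //= -ler_pdivlMl //.
  by rewrite -{1}[x](@scalerK _ _ a) ?unitfE ?gt_eqF // h ?invr_gt0.
Qed.

Lemma homothety_interior (mu : R) L f : 0 < mu -> interior L f -> interior (homothety mu L f) f.
Proof.
move=> mu0 /interior_rowP[e e0 Le]; apply/interior_rowP.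
exists (mu * e) => [|y fy]; first by rewrite mulr_gt0.
exists (f + mu^-1 *: (y - f)).
  apply: Le => i; rewrite !mxE opprD addNKr normrN normrM distrC.
  by rewrite gtr0_norm ?invr_gt0 // ltr_pdivrMl.
by apply/rowP => i; rewrite !mxE; field; rewrite gt_eqF.
Qed.

Lemma gauge_homothety (mu : R) B L f r : 0 < mu -> interior L f ->
  homothety mu L f `<=` B ->
  psi (translate B f) r <= mu^-1 * psi (translate L f) r.
Proof.
move=> mu0 Lf LB; apply/ler_addgt0Pr => e e0.
have me : 0 < mu * e by rewrite mulr_gt0.
have [k [k0 Lk kx]] := gauge_adherent L f r _ Lf me.
apply: le_trans (_ : mu^-1 * k <= _); last first.
  rewrite -(ler_pM2l mu0) mulrDr !mulVKf ?gt_eqF //; exact: ltW.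
apply: gauge_le; first by rewrite mulr_gt0 ?invr_gt0.
apply: LB; exists (f + k^-1 *: r) => //.
by apply/rowP => i; rewrite !mxE; field; rewrite !gt_eqF.
Qed.

Lemma affdim_interior C f : interior C f -> affdim C n.
Proof.
move=> /interior_rowP[e e0 Ce]; split; last first.
  by move=> [p [_]] h; have := rank_leq_col (\matrix_(i < n.+1) (p (lift ord0 i) - p ord0));
    rewrite h ltnn.
have e2 : 0 < e / 2 by rewrite divr_gt0.
exists (fun i => if unlift ord0 i is Some j then f + (e / 2) *: delta_mx ord0 j else f).
split=> [i|].
  case: unliftP => [j|] _; apply: Ce => l; last by rewrite subrr normr0.
  rewrite !mxE opprD addNKr normrN normrM gtr0_norm //.
  by case: (_ && _); rewrite ?normr1 ?normr0; lra.
rewrite (_ : \matrix_(_ < _) _ = (e / 2) *: 1%:M).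
  by rewrite mxrank_scale_nz ?mxrank1 // gt_eqF.
apply/matrixP => i j; rewrite mxE liftK unlift_none !mxE /=.
by rewrite addrAC subrr add0r eq_sym.
Qed.

(** Turns a sublinear limit of gauges back into a closed convex set with [f] in its interior, as
    [f_closed] requires. Closedness and interiority both come from the Lipschitz bound. *)
Lemma level_set_gauge (g : V -> R) f : sublinear g ->
  let C := [set x | g (x - f) <= 1] in
  [/\ in_Cn C, interior C f & forall r, psi (translate C f) r = g r].
Proof.
move=> sg C; have [g0 gD gZ] := sg.
have D0 : 0 <= sublip g by exact: sublip_ge0.
have Cf : interior C f.
  apply/interior_rowP; exists (sublip g + 1)^-1 => [|y fy].
    by rewrite invr_gt0 ltr_wpDl.
  rewrite /C /= (le_trans (@sublinear_le _ _ _ (sublip g + 1)^-1 _ sg _)) // => [i|].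
    by rewrite !mxE distrC ltW.
  by rewrite mulrC ler_pdivrMr ?ltr_wpDl // mul1r lerDl.
split=> // [|r].
  split; last split.
  - move=> x xC; rewrite /C /=; apply/ler_addgt0Pr => e e0.
    have e' : 0 < e / (sublip g + 1) by rewrite divr_gt0 // ltr_wpDl.
    have [y [Cy [_ xy]]] := xC _ (nbhsx_ballx x _ e').
    rewrite -[x - f](subrK (y - f)) (le_trans (gD _ _)) // addrC lerD //.
    rewrite opprB addrA subrK.
    rewrite (le_trans (@sublinear_le _ _ _ (e / (sublip g + 1)) _ sg _)) // => [i|].
      by rewrite !mxE ltW //; exact: (xy ord0 i).
    by rewrite mulrAC ler_pdivrMr ?ltr_wpDl // ler_pM2l // lerDl.
  - move=> x y t Cx Cy t0 t1; rewrite /C /=.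
    have -> : t *: x + (1 - t) *: y - f = t *: (x - f) + (1 - t) *: (y - f).
      by apply/rowP => i; rewrite !mxE; ring.
    rewrite (le_trans (gD _ _)) // !sublinearZ ?subr_ge0 //.
    rewrite -[leRHS](subrKC t) lerD // ler_piMr // subr_ge0 //.
  - exact: affdim_interior Cf.
apply/eqP; rewrite eq_le; apply/andP; split.
  apply/ler_addgt0Pr => e e0; have p0 : 0 < g r + e by rewrite ltr_wpDl.
  apply: gauge_le => //; rewrite /C /= addrAC subrr add0r gZ ?invr_gt0 //.
  by rewrite mulrC ler_pdivrMr // mul1r lerDl ltW.
rewrite psi_translate; apply: lb_le_inf.
  by have [l l0 Bl] := interior_segment C f r Cf; exists l.
move=> l [l0]; rewrite /C /= addrAC subrr add0r gZ ?invr_gt0 //.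
by rewrite mulrC ler_pdivrMr // mul1r.
Qed.

End Gauge.

(** * Compactness for sublinear functionals *)

Lemma rat_row_dense (R : realType) (n : nat) (x : 'rV[R]_n) (e : R) : 0 < e ->
  exists q : 'rV[rat]_n, forall i, `|x ord0 i - map_mx ratr q ord0 i| <= e.
Proof.
move=> e0.
have /fin_all_exists[q qx] : forall i, exists q : rat, `|x ord0 i - ratr q| <= e.
  move=> i; have [|q] := @rat_in_itvoo R (x ord0 i - e) (x ord0 i + e).
    by rewrite ltrD2l gtrN.
  rewrite in_itv /= => /andP[h1 h2]; exists q.
  by rewrite ler_norml; apply/andP; split; lra.
by exists (\row_i q i) => i; rewrite !mxE.
Qed.

(* Values along an ultrafilter give the limit function; equi-Lipschitz control
   reduces convergence everywhere to convergence at the countably many rational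
   points, which turns the ultrafilter limit into a sequential one. *)
Lemma sublinear_subsequence (R : realType) (n : nat) (phi : nat -> 'rV[R]_n -> R) :
  (forall t, sublinear (phi t)) -> (forall x, exists M, forall t, phi t x <= M) ->
  exists (u : nat -> nat) (g : 'rV[R]_n -> R), (forall k, (k <= u k)%N) /\
    forall x, (fun k => phi (u k) x) @ \oo --> g x.
Proof.
move=> sphi /choice[M phiM].
have [U [UU sU]] := @ultraFilterLemma nat \oo _.
have /choice[g gU] : forall x, exists l, forall e : R, 0 < e ->
    \forall t \near U, `|phi t x - l| < e.
  move=> x; have FF : ProperFilter (phi^~ x @ U) by exact: fmap_proper_filter.
  have [|l [_ ll]] := @segment_compact R 0 (M x) (phi^~ x @ U) FF.
    by apply: (@filterE _ U) => t /=; rewrite in_itv /= phiM andbT; have [] := sphi t.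
  exists l => e e0.
  (* Otherwise the complement belongs to [U], which contradicts that [l] is a cluster point. *)
  have [//|nU] := in_ultra_setVsetC [set t | `|phi t x - l| < e] UU.
  have [y [[t nt <-]]] := ll (phi^~ x @` ~` [set t | `|phi t x - l| < e])
    (ball l e) (filterS (fun t nt => ex_intro2 _ _ t nt erefl) nU) (nbhsx_ballx l e e0).
  by rewrite /ball /= distrC => h; case: nt.
pose D := \sum_(i < n) (M (delta_mx ord0 i) + M (- delta_mx ord0 i)).
have phiD t : sublip (phi t) <= D by apply: ler_sum => i _; rewrite lerD.
have D0 : 0 <= D by apply: le_trans (sublip_ge0 _ (sphi 0%N)) (phiD _).
have lip t (e : R) (x y : 'rV[R]_n) : 0 <= e -> (forall i, `|x ord0 i - y ord0 i| <= e) ->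
    `|phi t x - phi t y| <= e * D.
  move=> e0 xy; apply: le_trans (sublinear_dist _ _ _ _ (sphi t) xy) _.
  by rewrite ler_wpM2l.
pose q j : 'rV[R]_n := map_mx ratr (odflt 0 (unpickle j : option 'rV[rat]_n)).
(* A diagonal choice: index [u k] handles the first [k] rational points at once, as a finite
   intersection of members of [U]. *)
have /choice[u ku] : forall k, exists t, (k <= t)%N /\
    forall j : 'I_k, `|phi t (q j) - g (q j)| < k.+1%:R^-1.
  move=> k; apply: (@filter_ex _ U); apply: filterI.
    by apply: sU; exact: nbhs_infty_ge.
  by apply: filter_forall => j; apply: gU; rewrite invr_gt0.
exists u, g; split=> [k|x]; first by have [] := ku k.
apply/cvgrPdist_le => e e0.
have d0 : 0 < e / (8 * (D + 1)) by rewrite divr_gt0 // mulr_gt0 // ltr_wpDl.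
set d := e / (8 * (D + 1)) in d0.
have dD : d * D <= e / 8.
  by rewrite /d invfM mulrA mulrAC ler_pdivrMr ?ltr_wpDl // ler_pM2l ?lerDl // divr_gt0.
have e8 : 0 < e / 8 by rewrite divr_gt0.
have [r rx] := rat_row_dense _ _ x _ d0.
have rq : map_mx ratr r = q (pickle r) by rewrite /q pickleK.
set y := map_mx ratr r in rx rq.
have xy t : `|phi t x - phi t y| <= e / 8.
  by apply: le_trans dD; apply: lip => //; exact: ltW.
(* The limit [g] inherits the Lipschitz estimate through a single index [t] that is good at both [x]
   and [y]. *)
have gxy : `|g x - g y| <= 3 * (e / 8).
  have [t [tx ty]] := @filter_ex _ U _ _ (filterI (gU x _ e8) (gU y _ e8)).
  by move: (xy t) tx ty; rewrite !ler_norml !ltr_norml => /andP[? ?] /andP[? ?] /andP[? ?];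
    apply/andP; split; lra.
near=> k.
have [_ kq] := ku k.
have jk : (pickle r < k)%N by near: k; exact: nbhs_infty_gt.
have := kq (Ordinal jk); rewrite /= -rq => h.
have ek : k.+1%:R^-1 < e / 8 by near: k; exact: near_infty_natSinv_lt (PosNum e8).
move: (xy (u k)) gxy (lt_trans h ek); rewrite !ler_norml !ltr_norml.
by move=> /andP[? ?] /andP[? ?] /andP[? ?]; apply/andP; split; lra.
Unshelve. all: by end_near.
Qed.

(** * Normalised descriptions of polyhedra *)

Section Polyhedra.
Context {R : realType} {n : nat}.
Notation V := 'rV[R]_n.
Implicit Types (a f x y : V) (L : set V).

Lemma dotvE a x : dotv a x = (x *m a^T) ord0 ord0.
Proof. by rewrite mxE; apply: eq_bigr => i _; rewrite !mxE mulrC. Qed.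

Lemma dotvDr a x y : dotv a (x + y) = dotv a x + dotv a y.
Proof. by rewrite !dotvE mulmxDl mxE. Qed.

Lemma dotvZr a (s : R) x : dotv a (s *: x) = s * dotv a x.
Proof. by rewrite !dotvE -scalemxAl mxE. Qed.

Lemma dotvBr a x y : dotv a (x - y) = dotv a x - dotv a y.
Proof. by rewrite dotvDr -scaleN1r dotvZr mulN1r. Qed.

Lemma dotvZl (s : R) a x : dotv (s *: a) x = s * dotv a x.
Proof. by rewrite !dotvE linearZ /= -scalemxAr mxE. Qed.

Lemma dotv0l x : dotv 0 x = 0.
Proof. by rewrite dotvE trmx0 mulmx0 mxE. Qed.

Lemma dotv_gt0 a : a != 0 -> 0 < dotv a a.
Proof.
move=> a0; rewrite lt_def sumr_ge0 ?andbT => [|i _]; last by rewrite -expr2 sqr_ge0.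
apply: contra a0 => /eqP aa; apply/eqP/rowP => i; rewrite mxE.
have /psumr_eq0P/(_ aa i isT)/eqP : forall i : 'I_n, true -> 0 <= a ord0 i * a ord0 i.
  by move=> j _; rewrite -expr2 sqr_ge0.
by rewrite mulf_eq0 orbb => /eqP.
Qed.

Definition cut f (k : nat) (c : 'I_k -> V) : set V :=
  [set x | forall i, dotv (c i) (x - f) <= 1].
Arguments cut f {k} c.

(** A constraint with nonzero normal is strict at the interior point [f], since a step from [f]
    along the normal stays in [L]; dividing by the slack normalises it. *)
Lemma polyhedron_cut L f : polyhedron L -> interior L f ->
  exists (k : nat) (c : 'I_k -> V), L = cut f c.
Proof.
move=> [k [a [b LE]]] Lf.
have Lff : L f by exact: nbhs_singleton.
have ab i : a i != 0 -> dotv (a i) f < b i.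
  move=> ai0; have := Lff; rewrite {1}LE /= => /(_ i); rewrite le_eqVlt.
  case/orP => // /eqP abi.
  have [l l0] := interior_segment L f (a i) Lf.
  rewrite LE /= => /(_ i); rewrite dotvDr dotvZr abi gerDl leNgt.
  by rewrite mulr_gt0 ?invr_gt0 ?dotv_gt0.
exists k, (fun i => (b i - dotv (a i) f)^-1 *: a i).
rewrite {1}LE; apply/seteqP; split => x /= h i; move: (h i).
  rewrite dotvZl; have [->|ai0] := eqVneq (a i) 0; first by rewrite !dotv0l mulr0 ler01.
  by rewrite dotvBr mulrC ler_pdivrMr ?subr_gt0 ?ab // mul1r lerD2r.
rewrite dotvZl; have [ai0 _|ai0] := eqVneq (a i) 0.
  by have := Lff; rewrite {1}LE => /(_ i); rewrite ai0 !dotv0l.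
by rewrite dotvBr mulrC ler_pdivrMr ?subr_gt0 ?ab // mul1r lerD2r.
Qed.

End Polyhedra.
Arguments cut {R n} f {k} c.

(** * Facets and irredundant descriptions *)

Lemma pos_lower_bound (R : realType) (T : finType) (d : T -> R) :
  (forall t, 0 < d t) -> exists2 e, 0 < e & forall t, e <= d t.
Proof.
move=> d0; have [e [e0 ed]] := @filter_ex _ (0^'+ : set_system R) _ _
  (filterI (nbhs_right_gt 0) (filter_forall _ (fun t => nbhs_right_le (d0 t)))).
by exists e.
Qed.

(** Near [z] only constraint [i] is tight, so short steps from [z] orthogonal to [c i] stay in the
    face and give its dimension. One dimension more would force [c i] to be zero. *)
Lemma irredundant_facet (R : realType) (n k : nat) (f : 'rV[R]_n.+1)
    (c : 'I_k -> 'rV[R]_n.+1) (i : 'I_k) (z : 'rV[R]_n.+1) :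
  dotv (c i) (z - f) = 1 -> (forall j, j != i -> dotv (c j) (z - f) < 1) ->
  is_facet (cut f c) [set x | cut f c x /\ dotv (c i) x = 1 + dotv (c i) f].
Proof.
move=> zi zj.
have ci0 : c i != 0.
  by apply/eqP => c0; move: zi; rewrite c0 dotv0l => /eqP; rewrite eq_sym oner_eq0.
split.
  exists (c i), (1 + dotv (c i) f); split=> //; split=> // x /(_ i).
  by rewrite dotvBr lerBlDr.
split=> /=; last first.
  move=> [p [pF rk]]; case/negP: ci0; rewrite -trmx_eq0.
  set M := \matrix_(_ < _) _ in rk.
  have Mu : M \in unitmx by rewrite -row_free_unit -row_leq_rank rk.
  rewrite -(mulKmx Mu (c i)^T) (_ : M *m _ = 0) ?mulmx0 //.
  apply/row_matrixP => j; rewrite row_mul rowK row0.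
  apply/rowP => o; rewrite ord1 -dotvE dotvBr mxE.
  by have [_ ->] := pF (lift ord0 j); have [_ ->] := pF ord0; rewrite subrr.
have [K [rK K0]] : exists K : 'M[R]_(n, n.+1), \rank K = n /\ K *m (c i)^T = 0.
  have rk : \rank (kermx (c i)^T) = n.
    by rewrite mxrank_ker mxrank_tr rank_rV ci0 subn1.
  have base r (A : 'M[R]_n.+1) : \rank A = r -> exists K : 'M[R]_(r, n.+1), (K :=: A)%MS.
    by move=> <-; exists (row_base A); exact: eq_row_base.
  have [K KE] := base _ _ rk.
  exists K; rewrite KE; split=> //; apply/eqP; rewrite -sub_kermx.
  by rewrite -KE submx_refl.
have dK l : dotv (c i) (row l K) = 0 by rewrite dotvE -row_mul K0 row0 mxE.
(* A step length along row [t.2] that does not use up the slack of constraint [t.1]; for [i] any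
   length will do, because the rows of [K] are orthogonal to [c i]. *)
pose d (t : 'I_k * 'I_n) : R := if t.1 == i then 1 else
  (1 - dotv (c t.1) (z - f)) / (1 + `|dotv (c t.1) (row t.2 K)|).
have [|e e0 ed] := @pos_lower_bound R _ d.
  move=> [j l]; rewrite /d /=; case: ifPn => // ji.
  by rewrite divr_gt0 ?subr_gt0 ?zj // ltr_pwDl.
have zL : cut f c z.
  by move=> j; have [->|/zj/ltW//] := eqVneq j i; rewrite zi.
exists (fun o => if unlift ord0 o is Some l then z + e *: row l K else z); split.
  move=> o; case: unliftP => [l|] _ /=; split=> //.
  - move=> j; rewrite addrAC dotvDr dotvZr; have [->|ji] := eqVneq j i.
      by rewrite dK mulr0 addr0 zi.
    have := ed (j, l); rewrite /d /= (negPf ji) ler_pdivlMr ?ltr_pwDl // mulrDr mulr1 => h.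
    have : e * dotv (c j) (row l K) <= e * `|dotv (c j) (row l K)|.
      by rewrite ler_pM2l // ler_norm.
    by move=> ?; lra.
  - by rewrite dotvDr dotvZr dK mulr0 addr0; move: zi; rewrite dotvBr => ?; lra.
  - by move: zi; rewrite dotvBr => ?; lra.
rewrite (_ : \matrix_(_ < _) _ = e *: K) ?mxrank_scale_nz ?gt_eqF //.
by apply/row_matrixP => l; rewrite rowK liftK unlift_none addrAC subrr add0r linearZ.
Qed.

(** The segment from [f] to a point violating only constraint [i] crosses that hyperplane where all
    other constraints are strict. Hence each [i] yields a facet, and the crossing point separates it
    from the facets of the other constraints. *)
Lemma irredundant_card (R : realType) (n k m : nat) (f : 'rV[R]_n.+1)
    (c : 'I_k -> 'rV[R]_n.+1) :
  (forall i, exists y, (forall j, j != i -> dotv (c j) (y - f) <= 1) /\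
     1 < dotv (c i) (y - f)) ->
  at_most_facets (cut f c) m -> (k <= m)%N.
Proof.
move=> irr [Fs FsP].
have /fin_all_exists[z zP] : forall i, exists z : 'rV[R]_n.+1,
    dotv (c i) (z - f) = 1 /\ forall j, j != i -> dotv (c j) (z - f) < 1.
  move=> i; have [y [yj yi]] := irr i; have y0 := lt_trans ltr01 yi.
  exists (f + (dotv (c i) (y - f))^-1 *: (y - f)).
  rewrite addrAC subrr add0r; split=> [|j ji]; rewrite dotvZr.
    by rewrite mulVf // gt_eqF.
  by rewrite mulrC ltr_pdivrMr // mul1r (le_lt_trans _ yi) // yj.
pose F i := [set x | cut f c x /\ dotv (c i) x = 1 + dotv (c i) f].
have /fin_all_exists[phi phiP] : forall i, exists o, F i = Fs o.
  by move=> i; apply: FsP; have [z1 z2] := zP i; exact: irredundant_facet z1 z2.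
have zL i : cut f c (z i).
  by move=> j; have [zi zj] := zP i; have [->|/zj/ltW//] := eqVneq j i; rewrite zi.
have /leq_card : injective phi.
  move=> i j ij; apply/eqP; apply: contraT => ne.
  have : F j (z i).
    rewrite phiP -ij -phiP; split=> //.
    by have [<- _] := zP i; rewrite dotvBr subrK.
  move=> [_]; have [_ /(_ j)] := zP i; rewrite eq_sym ne => /(_ isT).
  by rewrite dotvBr => h e1; rewrite e1 addrK ltxx in h.
by rewrite !card_ord.
Qed.

Lemma polyhedron_few_facets (R : realType) (n m : nat) (f : 'rV[R]_n.+1) L :
  polyhedron L -> interior L f -> at_most_facets L m ->
  exists c : 'I_m -> 'rV[R]_n.+1, L = cut f c.
Proof.
move=> Lp Lf Lm.
have ex : exists k, `[< exists c : 'I_k -> 'rV[R]_n.+1, L = cut f c >].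
  by have [k [c Lc]] := polyhedron_cut L f Lp Lf; exists k; apply/asboolP; exists c.
case: (ex_minnP ex) => k /asboolP[c Lc] kmin.
have km : (k <= m)%N.
  apply: (irredundant_card _ _ _ _ f c); last by rewrite -Lc.
  move=> i; apply: contrapT => ny.
  case: k => [|k] in c Lc kmin i ny *; first by case: i {ny}.
  have /kmin : `[< exists c : 'I_k -> 'rV[R]_n.+1, L = cut f c >].
    apply/asboolP; exists (c \o lift i); rewrite Lc.
    apply/seteqP; split=> x cx j; first exact: cx.
    have [->|ji] := eqVneq j i; last first.
      by have [l ->|jE] := unliftP i j; [exact: cx | rewrite jE eqxx in ji].
    rewrite leNgt; apply/negP => lt1; apply: ny; exists x; split=> // l li.
    by have [l' ->|lE] := unliftP i l; [exact: cx | rewrite lE eqxx in li].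
  by rewrite ltnn.
(* Zero vectors, whose constraints are vacuous, pad the description to exactly [m] cuts. *)
exists (fun j => oapp c 0 (insub (j : nat) : option 'I_k)); rewrite Lc.
apply/seteqP; split=> x cx j.
  by case: insubP => [i _ _|_] /=; [exact: cx | rewrite dotv0l ler01].
by have := cx (widen_ord km j); rewrite /= insubT ?ltn_ord //= => jk;
  rewrite (_ : Sub _ _ = j) //; apply: val_inj.
Qed.

(** * Bounded generation of polyhedra *)

(** One generator per sign pattern and per set of constraints: [m] cuts, the homogenising condition
    [None], and [n] sign conditions. *)
Definition generator_index (n m : nat) : finType :=
  ({ffun 'I_n -> bool} * {set option 'I_m + 'I_n})%type.

(* The sign pattern [s] confines the homogenized cone to an orthant, where it is
   pointed, so that lineality directions need no separate treatment. *)
Lemma cut_generators (R : realType) (n m : nat) (c : 'I_m -> 'rV[R]_n) :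
  exists (p : generator_index n m -> 'rV[R]_n) (t : generator_index n m -> R),
  [/\ forall j, 0 <= t j, forall j i, dotv (c i) (p j) <= t j &
    forall x, (forall i, dotv (c i) x <= 1) ->
      exists a : generator_index n m -> R,
        [/\ forall j, 0 <= a j, x = \sum_j a j *: p j & \sum_j a j * t j = 1]].
Proof.
pose l (s : {ffun 'I_n -> bool}) (j : option 'I_m + 'I_n) (w : 'rV[R]_n * R^o) : R :=
  match j with
  | inl None => w.2
  | inl (Some i) => w.2 - dotv (c i) w.1
  | inr o => (-1) ^+ s o * w.1 ord0 o
  end.
have llin s j a u v : l s j (a *: u + v) = a * l s j u + l s j v.
  by case: j => [[i|]|o] //=; rewrite ?dotvDr ?dotvZr ?mxE /=; rewrite /GRing.scale /=; ring.
have /fin_all_exists[P PP] s := cone_generators _ _ _ (l s) (llin s).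
exists (fun j => (P j.1 j.2).1), (fun j => (P j.1 j.2).2); split.
- by move=> [s I]; have [+ _] := PP s => /(_ I (inl None)).
- by move=> [s I] i; have [+ _] := PP s => /(_ I (inl (Some i))); rewrite subr_ge0.
move=> x cx; pose s := [ffun o => x ord0 o < 0].
have [_ /(_ (x, 1))[j|a [a0 aE]]] := PP s.
  case: j => [[i|]|o] /=; rewrite ?subr_ge0 ?ler01 //.
  rewrite ffunE; have [x0|x0] := ltP (x ord0 o) 0.
    by rewrite expr1 mulN1r oppr_ge0 ltW.
  by rewrite expr0 mul1r.
have sumE (M : nmodType) (F : {set option 'I_m + 'I_n} -> M) (G : generator_index n m -> M) :
    (forall I, G (s, I) = F I) -> (forall s' I, s' != s -> G (s', I) = 0) ->
    \sum_j G j = \sum_I F I.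
  move=> GF G0; rewrite (eq_bigr (fun j => G (j.1, j.2))) => [|[]//].
  rewrite -(pair_bigA _ (fun s I => G (s, I))) /= (bigD1 s) //= [X in _ + X]big1 ?addr0.
    exact: eq_bigr.
  by move=> s' s's; apply: big1 => I _; exact: G0.
exists (fun j => if j.1 == s then a j.2 else 0); split=> [j||].
- by case: ifP.
- rewrite (sumE _ (fun I => a I *: (P s I).1)) => [|I|s' I /negPf s's] /=; last 2 first.
  + by rewrite eqxx.
  + by rewrite s's scale0r.
  (* The sign constraints are the coordinates up to sign, so equal constraint values give equal
     vectors. *)
  apply/rowP => o; rewrite summxE; apply: (inv_inj (signrMK (s o))).
  have /= -> := aE (inr o); rewrite mulr_sumr; apply: eq_bigr => I _.
  by rewrite mxE mulrCA.
- rewrite (sumE _ (fun I => a I * (P s I).2)) => [|I|s' I /negPf s's] /=; last 2 first.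
  + by rewrite eqxx.
  + by rewrite s's mul0r.
  by have /= <- := aE (inl None).
Qed.

(** * Inclusions of cut regions and homotheties *)

Section Main.
Context {R : realType} {n : nat}.
Notation V := 'rV[R]_n.
Context (cB cL : set (set V)) (f : V).

(** Lets the generators be indexed by [generator_index] instead of an ordinal, and restricts
    attention to sets with [f] in the interior. *)
Lemma CFam_finType (J : finType) (alpha : R) (r : J -> V) (s : J -> R) :
  0 < alpha ->
  (forall k (r : 'I_k -> V), CFam cB r f `<=` scale_fam alpha^-1 (CFam cL r f)) ->
  (forall j, 0 <= s j) ->
  (forall B, fam_f cB f B -> 1 <= \sum_j s j * psi (translate B f) (r j)) ->
  forall L, fam_f cL f L -> 1 <= alpha * \sum_j s j * psi (translate L f) (r j).
Proof.
move=> a0 BL s0 sB L [cLL Lf].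
have sumE (F : J -> R) : \sum_j F j = \sum_(i < #|J|) F (enum_val i).
  by rewrite (reindex (@enum_val J J)) //; exact/onW_bij/enum_val_bij.
have [|t [_ tL] tE] := BL #|J| (r \o enum_val) (s \o enum_val).
  split=> [j|B cBB]; first exact: s0.
  split=> [j|Bf]; first exact: s0.
  by have := sB B (conj cBB Bf); rewrite sumE.
have [_ /(_ Lf)] := tL L cLL.
rewrite sumE mulr_sumr; congr (_ <= _); apply: eq_bigr => i _.
have /= <- : alpha^-1 * t i = (s \o enum_val) i by rewrite -tE.
by rewrite mulrA mulrA divff ?gt_eqF // mul1r.
Qed.

Lemma rho_f_le (mu : R) : 0 < mu ->
  (forall L, fam_f cL f L -> exists B, cB B /\ homothety mu L f `<=` B) ->
  (rho_f cB cL f <= mu^-1%:E)%E.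
Proof.
move=> mu0 LB; apply: ereal_inf_lbound; exists mu^-1 => //; split=> [|k r s [s0 sB]].
  by rewrite invr_gt0.
exists (fun j => mu^-1 * s j); last by apply/funext => j; rewrite invrK mulVKf ?gt_eqF.
have s'0 : nonneg (fun j => mu^-1 * s j).
  by move=> j; rewrite mulr_ge0 ?invr_ge0 ?(ltW mu0).
split=> // L cLL; split=> // Lf; have [B [cBB muLB]] := LB L (conj cLL Lf).
have [_] := sB B cBB.
have Bf : interior B f by apply: (interiorS muLB); exact: homothety_interior.
move=> /(_ Bf)/le_trans; apply; apply: ler_sum => j _.
by rewrite -mulrA mulrCA ler_wpM2l //; exact: gauge_homothety.
Qed.

Lemma homothety_in_family (m : nat) (c : 'I_m -> V) (L : set V) (alpha mu : R) :
  (forall B, cB B -> in_Cn B) -> f_closed cB f ->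
  0 < alpha ->
  (forall k (r : 'I_k -> V), CFam cB r f `<=` scale_fam alpha^-1 (CFam cL r f)) ->
  L = cut f c -> fam_f cL f L ->
  0 < mu -> alpha * (mu * #|generator_index n m|%:R) < 1 ->
  exists B, cB B /\ homothety mu L f `<=` B.
Proof.
move=> cBn clB a0 BL LE fL mu0 amu.
have [p [t [t0 pt gen]]] := cut_generators _ _ _ c.
have Lf : interior L f by case: fL.
have psiL j : psi (translate L f) (p j) <= t j.
  apply/ler_addgt0Pr => e e0; have te : 0 < t j + e by rewrite ltr_wpDl.
  apply: gauge_le => //; rewrite LE => i; rewrite addrAC subrr add0r dotvZr.
  by rewrite mulrC ler_pdivrMr // mul1r (le_trans (pt j i)) // lerDl ltW.
(* Directions with [t j = 0] lie in the recession cone of [L], so an arbitrarily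
   large weight on them costs nothing. *)
pose w N j : R := if t j == 0 then N.+1%:R else mu / t j.
have w0 N j : 0 < w N j.
  by rewrite /w; case: ifPn => // tj; rewrite divr_gt0 // lt_def tj t0.
(* If every [B] failed at some generator, the weights [w N] would satisfy all cuts from [cB], while
   each generator contributes at most [mu] to the sum for [L]. *)
have /choice[B BP] : forall N, exists B, fam_f cB f B /\
    forall j, w N j * psi (translate B f) (p j) <= 1.
  move=> N; apply: contrapT => nB.
  have : 1 <= alpha * \sum_j w N j * psi (translate L f) (p j).
    apply: (CFam_finType _ _ _ _ a0 BL) fL => [j|B fB]; first exact: ltW.
    have [j jB] : exists j, 1 < w N j * psi (translate B f) (p j).
      apply: contrapT => nj; apply: nB; exists B; split=> // j.
      by rewrite leNgt; apply/negP => h; apply: nj; exists j.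
    have [cBB Bf] := fB; have [_ [cvB _]] := cBn B cBB.
    have [psi0 _ _] := gauge_sublinear B f cvB Bf.
    rewrite (bigD1 j) //= (le_trans (ltW jB)) // lerDl sumr_ge0 // => i _.
    by rewrite mulr_ge0 // ltW.
  apply/negP; rewrite -ltNge; apply: le_lt_trans amu; rewrite ler_pM2l //.
  rewrite mulr_natr -sumr_const; apply: ler_sum => j _.
  apply: le_trans (_ : w N j * t j <= _); first by rewrite ler_pM2l.
  by rewrite /w; case: eqP => [->|/eqP tj]; [rewrite mulr0 ltW | rewrite divfK].
pose phi N := psi (translate (B N) f).
have sphi N : sublinear (phi N).
  by have [[cBB Bf] _] := BP N; have [_ [cvB _]] := cBn _ cBB; exact: gauge_sublinear.
have phip N j : phi N (p j) <= (w N j)^-1.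
  by have [_ /(_ j)] := BP N; rewrite mulrC -ler_pdivlMr // mul1r.
(* Pointwise boundedness: a positive multiple of [x] lies in [L - f], hence is a combination of
   generators. The summand [1] covers those with [t j = 0]. *)
have [x|u [g [ku ug]]] := sublinear_subsequence _ _ phi sphi.
  have [l l0] := interior_segment L f x Lf; rewrite LE => Lx.
  have [|a [a_ge0 aE _]] := gen (l^-1 *: x).
    by move=> i; have := Lx i; rewrite addrAC subrr add0r.
  exists (l * \sum_j a j * (t j / mu + 1)) => N.
  have -> : x = l *: \sum_j a j *: p j.
    by rewrite -aE scalerA mulfV ?scale1r // gt_eqF.
  rewrite sublinearZ ?(ltW l0) // ler_pM2l //.
  apply: le_trans (sublinear_sum _ _ _ _ (sphi N) a_ge0) _.
  apply: ler_sum => j _; rewrite ler_wpM2l // (le_trans (phip N j)) // /w.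
  case: eqP => [->|_]; last by rewrite invf_div lerDl.
  by rewrite mul0r add0r invf_le1 // ler1n.
have sg : sublinear g.
  split=> [x|x y|b x b0].
  - apply: ler_cvg_to (cvg_cst 0) (ug x) _; apply: nearW => k; by have [] := sphi (u k).
  - apply: ler_cvg_to (ug _) (cvgD (ug x) (ug y)) _; apply: nearW => k.
    by have [] := sphi (u k).
  - apply: (cvg_unique _ (ug _)) => //.
    rewrite (_ : (fun k => _) = (fun k => b * phi (u k) x)); first exact: cvgMr.
    by apply/funext => k; have [_ _ ->] := sphi (u k).
have gp j : g (p j) <= t j / mu.
  have [tj|tj] := eqVneq (t j) 0.
    (* Since [k <= u k], the bound [(u k).+1^-1] is at most the harmonic sequence, so [g] is at most
       [0] on this direction. *)
    rewrite tj mul0r; apply: ler_cvg_to (ug _) (@cvg_harmonic R) _.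
    apply: nearW => k; apply: le_trans (phip _ _) _; rewrite /w tj eqxx /harmonic /=.
    by rewrite lef_pV2 ?posrE // ler_nat ltnS.
  apply: ler_cvg_to (ug _) (cvg_cst _) _; apply: nearW => k.
  by apply: le_trans (phip _ _) _; rewrite /w (negPf tj) invf_div.
have [Cn Cf psiC] := level_set_gauge g f sg.
exists [set x | g (x - f) <= 1]; split.
  suff [] : fam_f cB f [set x | g (x - f) <= 1] by [].
  apply: (clB (B \o u)) => // [k|r]; first by have [] := BP (u k).
  by rewrite psiC; exact: ug.
move=> _ [x Lx <-] /=.
rewrite (_ : _ - f = mu *: (x - f)); last by apply/rowP => i; rewrite !mxE; ring.
have [|a [a_ge0 -> at1]] := gen (x - f); first by move: Lx; rewrite LE.
rewrite sublinearZ ?(ltW mu0) // mulrC -ler_pdivlMr // mul1r.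
apply: le_trans (sublinear_sum _ _ _ _ sg a_ge0) _.
apply: le_trans (_ : \sum_j a j * (t j / mu) <= _).
  by apply: ler_sum => j _; rewrite ler_wpM2l.
by under eq_bigr do rewrite mulrA; rewrite -mulr_suml at1 mul1r.
Qed.

End Main.

(** * A uniform ratio and the two equivalences *)

(** Independent of [f] and [L], as part (b) demands. The summand [2] keeps the ratio below [1] and
    its product with [A] and the number of generators strictly below [1]. *)
Definition homothety_ratio {R : realType} (n m : nat) (A : R) : R :=
  (A * #|generator_index n m|%:R + 2)^-1.

Lemma homothety_ratio_bounds (R : realType) (n m : nat) (A : R) : 0 < A ->
  0 < homothety_ratio n m A /\ homothety_ratio n m A < 1.
Proof.
move=> A0; have h : 0 <= A * #|generator_index n m|%:R by rewrite mulr_ge0 // ltW.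
by split; rewrite ?invr_gt0 ?invf_lt1; lra.
Qed.

Lemma rho_f_lt_homothety (R : realType) (n m : nat) (cB cL : set (set 'rV[R]_n))
    (f : 'rV[R]_n) (A : R) :
  (forall B, cB B -> in_Cn B) ->
  (forall L, cL L -> in_Cn L /\ polyhedron L /\ at_most_facets L m) ->
  ~ integral_vec f -> f_closed cB f -> 0 < A -> (rho_f cB cL f < A%:E)%E ->
  forall L, fam_f cL f L -> exists B, cB B /\ homothety (homothety_ratio n m A) L f `<=` B.
Proof.
(* In dimension [0] every vector is integral, so no admissible [f] exists. *)
case: n cB cL f => [|n] cB cL f cBn cLm nf clB A0; first by case: nf => -[].
move=> /ereal_inf_lt[_ [a [a0 BL] <-]]; rewrite lte_fin => aA L fL.
have [cLL Lf] := fL; have [_ [Lp Lm]] := cLm L cLL.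
have [c LE] := polyhedron_few_facets _ _ _ _ _ Lp Lf Lm.
have [r0 _] := homothety_ratio_bounds R n.+1 m A A0.
apply: (homothety_in_family _ _ _ _ c _ a) => //.
rewrite /homothety_ratio [_^-1 * _]mulrC mulrA ltr_pdivrMr; last first.
  by rewrite -invr_gt0.
rewrite mul1r; have : a * #|generator_index n.+1 m|%:R <= A * #|generator_index n.+1 m|%:R.
  by rewrite ler_wpM2r // ltW.
by move=> ?; lra.
Qed.

Theorem theorem2p4 (R : realType) (n : nat) (cB cL : set (set 'rV[R]_n)) (m : nat) :
  (forall B, cB B -> in_Cn B) ->
  (forall L, cL L -> in_Cn L /\ polyhedron L /\ at_most_facets L m) ->
  (forall f : 'rV[R]_n, ~ integral_vec f -> f_closed cB f ->
     ((rho_f cB cL f < +oo)%E <->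
      exists mu : R, 0 < mu /\ mu < 1 /\
        forall L, fam_f cL f L -> exists B, cB B /\ homothety mu L f `<=` B)) /\
  ((forall f : 'rV[R]_n, ~ integral_vec f -> f_closed cB f) ->
     ((rho cB cL < +oo)%E <->
      exists mu : R, 0 < mu /\ mu < 1 /\
        forall f : 'rV[R]_n, ~ integral_vec f ->
        forall L, fam_f cL f L -> exists B, cB B /\ homothety mu L f `<=` B)).
Proof.
move=> cBn cLm.
have ubound (x : \bar R) : (x < +oo)%E -> exists2 A : R, 0 < A & (x < A%:E)%E.
  (* The value [-oo] does arise: [rho] is a supremum over the empty set when [n = 0]. *)
  case: x => [x _|//|_]; last by exists 1; rewrite ?ltNyr.
  by exists (`|x| + 1); rewrite ?ltr_wpDl // lte_fin (le_lt_trans (ler_norm x)) ?ltrDl.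
split=> [f nf clB|clB]; split.
- move=> /ubound[A A0 rA]; exists (homothety_ratio n m A).
  have [r0 r1] := homothety_ratio_bounds R n m A A0.
  by split=> //; split=> // L; exact: rho_f_lt_homothety.
- by move=> [mu [mu0 [_ h]]]; apply: le_lt_trans (rho_f_le _ _ _ mu mu0 h) (ltry _).
- move=> /ubound[A A0 rA]; exists (homothety_ratio n m A).
  have [r0 r1] := homothety_ratio_bounds R n m A A0.
  split=> //; split=> // f nf L; apply: rho_f_lt_homothety => //; first exact: clB.
  by apply: le_lt_trans rA; apply: ereal_sup_ubound; exists f.
- move=> [mu [mu0 [_ h]]]; apply: le_lt_trans (ltry mu^-1).
  by apply: ge_ereal_sup => _ [f nf <-]; apply: rho_f_le => //; exact: h.
Qed.
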